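(* Let $\mathcal G$ be a finite groupoid and $\theta\in Z^2(\mathcal G,U(1))$ a two-cocycle. The $\theta$-twisted representation group of $\mathcal G$ splits as the direct sum of the twisted representation groups of its automorphism groups: $$\mathrm{Rep}^\theta(\mathcal G)\cong\bigoplus_{[x]\subset\mathcal G}\mathrm{Rep}^{\theta|_x}(\mathrm{Aut}(x)),$$ where $x$ runs over one object from each connected component of $\mathcal G$.
   Context: A finite groupoid is a category with finitely many objects and morphisms, all invertible. $\mathrm{Aut}(x)=\mathrm{Mor}_{\mathcal G}(x,x)$. Two-cocycles. A (normalized) two-cocycle $\theta\in Z^2(\mathcal G,U(1))$ assigns to each composable pair $x_2\xleftarrow{g_2}x_1\xleftarrow{g_1}x_0$ an element $\theta([g_2|g_1])\in U(1)$, equal to $1$ if $g_1$ or $g_2$ is an identity, such that $\theta([g_2|g_1])\,\theta([g_3g_2|g_1])^{-1}\,\theta([g_3|g_2g_1])\,\theta([g_3|g_2])^{-1}=1$ for all composable triples. $\theta|_x$ is the restriction of $\theta$ to the group $\mathrm{Aut}(x)$. Twisted representations. A $\theta$-twisted representation $F$ of $\mathcal G$ assigns to each object $x$ a finite-dimensional complex vector space $F(x)$ and to each morphism $g\colon x_1\to x_2$ a linear map $F(g)\colon F(x_1)\to F(x_2)$ such that $F(\mathrm{id}_x)=\mathrm{id}$ and $F(g_2)F(g_1)=\theta([g_2|g_1])F(g_2\circ g_1)$ for composable $g_2,g_1$. A morphism $F\Rightarrow F'$ is a family of linear maps $T(x)\colon F(x)\to F'(x)$ with $T(y)F(g)=F'(g)T(x)$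 for all $g\colon x\to y$. $\mathrm{Rep}^\theta(\mathcal G)$ is the Grothendieck group of the category of $\theta$-twisted representations. For a group $H$ with two-cocycle $\psi$, $\mathrm{Rep}^\psi(H)$ denotes the same construction for the one-object groupoid with morphism group $H$. *)

(* Defs.v *)
From HB Require Import structures.
From mathcomp Require Import all_boot all_order all_algebra.
From mathcomp Require Import boolp reals.
From mathcomp Require Import complex.

Set Implicit Arguments.
Unset Strict Implicit.
Unset Printing Implicit Defensive.

Import Order.TTheory GRing.Theory Num.Theory.

Local Open Scope ring_scope.

(** The twisted representations on arbitrary finite-dimensional spaces form a
    type too large, universe-wise, for the carrier of a [zmodType] or of any
    other structure below [vectType].  [abGroupType] is an abelian group whose
    carrier lives in an unconstrained universe and need not be a
    [choiceType]. *)
HB.mixin Record isAbGroup V := {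
  abg_zero : V;
  abg_opp : V -> V;
  abg_add : V -> V -> V;
  abg_addA : associative abg_add;
  abg_addC : commutative abg_add;
  abg_add0 : left_id abg_zero abg_add;
  abg_addN : left_inverse abg_zero abg_opp abg_add }.

#[short(type="abGroupType")]
HB.structure Definition AbGroup := {V of isAbGroup V}.

Arguments abg_zero {_}.

Definition abg_isomorphic (A B : abGroupType) : Prop :=
  exists f : A -> B, {morph f : x y / abg_add x y} /\ bijective f.

Section Presentation.
Variable T : Type.

Inductive zexpr : Type :=
  | ZGen of T
  | ZZero
  | ZOpp of zexpr
  | ZAdd of zexpr & zexpr.

Variable rel : zexpr -> zexpr -> Prop.

Inductive zeqv : zexpr -> zexpr -> Prop :=
  | zeqv_rel u v of rel u v : zeqv u v
  | zeqv_refl u : zeqv u u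
  | zeqv_sym u v of zeqv u v : zeqv v u
  | zeqv_trans u v w of zeqv u v & zeqv v w : zeqv u w
  | zeqv_opp u u' of zeqv u u' : zeqv (ZOpp u) (ZOpp u')
  | zeqv_add u u' v v' of zeqv u u' & zeqv v v' : zeqv (ZAdd u v) (ZAdd u' v')
  | zeqv_addA u v w : zeqv (ZAdd u (ZAdd v w)) (ZAdd (ZAdd u v) w)
  | zeqv_addC u v : zeqv (ZAdd u v) (ZAdd v u)
  | zeqv_add0 u : zeqv (ZAdd ZZero u) u
  | zeqv_addN u : zeqv (ZAdd (ZOpp u) u) ZZero.

(** The quotient of [zexpr] by [zeqv], as the type of equivalence classes. *)
Definition presented : Type := {S : zexpr -> Prop | exists u, S = zeqv u}.

Definition presented_pi (u : zexpr) : presented :=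
  exist _ (zeqv u) (ex_intro _ u erefl).

Definition presented_repr (x : presented) : zexpr := projT1 (cid (proj2_sig x)).

Lemma presented_reprK : cancel presented_repr presented_pi.
Proof.
move=> [S eS]; rewrite /presented_repr /=; case: cid => u /= Su.
by subst S; congr (exist _ _ _); apply: Prop_irrelevance.
Qed.

Lemma presented_piP u v : presented_pi u = presented_pi v <-> zeqv u v.
Proof.
split=> [[E]|uv]; first by rewrite E; apply: zeqv_refl.
apply: eq_exist => /=; apply/funext => w; apply/propext.
by split; apply: zeqv_trans => //; apply: zeqv_sym.
Qed.

Lemma presented_piK u : zeqv (presented_repr (presented_pi u)) u.
Proof. by apply/presented_piP; rewrite presented_reprK. Qed.

Definition presented_zero : presented := presented_pi ZZero.
Definition presented_opp (x : presented) : presented :=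
  presented_pi (ZOpp (presented_repr x)).
Definition presented_add (x y : presented) : presented :=
  presented_pi (ZAdd (presented_repr x) (presented_repr y)).

Lemma presented_piN u : presented_opp (presented_pi u) = presented_pi (ZOpp u).
Proof. by apply/presented_piP/zeqv_opp/presented_piK. Qed.

Lemma presented_piD u v :
  presented_add (presented_pi u) (presented_pi v) = presented_pi (ZAdd u v).
Proof. by apply/presented_piP/zeqv_add; apply: presented_piK. Qed.

Lemma presented_addA : associative presented_add.
Proof.
move=> x y z; rewrite -(presented_reprK x) -(presented_reprK y).
rewrite -(presented_reprK z) !presented_piD.
by apply/presented_piP; apply: zeqv_addA.
Qed.

Lemma presented_addC : commutative presented_add.
Proof. by move=> x y; apply/presented_piP; apply: zeqv_addC. Qed.

Lemma presented_add0 : left_id presented_zero presented_add.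
Proof.
move=> x; rewrite -(presented_reprK x) presented_piD.
by apply/presented_piP; apply: zeqv_add0.
Qed.

Lemma presented_addN : left_inverse presented_zero presented_opp presented_add.
Proof.
move=> x; rewrite -(presented_reprK x) presented_piN presented_piD.
by apply/presented_piP; apply: zeqv_addN.
Qed.

HB.instance Definition _ := isAbGroup.Build presented
  presented_addA presented_addC presented_add0 presented_addN.

End Presentation.

Arguments ZGen {T} _.
Arguments ZZero {T}.

(** For a finite index type the direct sum is the product. *)
Definition dsum (I : finType) (V : I -> abGroupType) : Type := forall i, V i.

Section DirectSum.
Variables (I : finType) (V : I -> abGroupType).
Implicit Types u v w : dsum V.

Definition dsum_zero : dsum V := fun i => abg_zero.
Definition dsum_opp u : dsum V := fun i => abg_opp (u i).
Definition dsum_add u v : dsum V := fun i => abg_add (u i) (v i).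

Lemma dsum_addA : associative dsum_add.
Proof. by move=> u v w; apply: functional_extensionality_dep => i; apply: abg_addA. Qed.

Lemma dsum_addC : commutative dsum_add.
Proof. by move=> u v; apply: functional_extensionality_dep => i; apply: abg_addC. Qed.

Lemma dsum_add0 : left_id dsum_zero dsum_add.
Proof. by move=> u; apply: functional_extensionality_dep => i; apply: abg_add0. Qed.

Lemma dsum_addN : left_inverse dsum_zero dsum_opp dsum_add.
Proof. by move=> u; apply: functional_extensionality_dep => i; apply: abg_addN. Qed.

HB.instance Definition _ := isAbGroup.Build (dsum V)
  dsum_addA dsum_addC dsum_add0 dsum_addN.

End DirectSum.

Record finGroupoid := FinGroupoid {
  gobj :> finType;
  gmor : gobj -> gobj -> finType;
  gid : forall x, gmor x x;
  gcomp : forall x y z, gmor y z -> gmor x y -> gmor x z;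
  ginv : forall x y, gmor x y -> gmor y x;
  gcompA : forall w x y z (h : gmor y z) (g : gmor x y) (f : gmor w x),
    gcomp h (gcomp g f) = gcomp (gcomp h g) f;
  gcomp1m : forall x y (g : gmor x y), gcomp (gid y) g = g;
  gcompm1 : forall x y (g : gmor x y), gcomp g (gid x) = g;
  gcompVm : forall x y (g : gmor x y), gcomp (ginv g) g = gid x;
  gcompmV : forall x y (g : gmor x y), gcomp g (ginv g) = gid y }.

Arguments gmor {_} _ _.
Arguments gid {_} _.
Arguments gcomp {_ _ _ _} _ _.
Arguments ginv {_ _ _} _.

Definition gconnected (G : finGroupoid) : rel G :=
  [rel x y | (0 < #|gmor x y|)%N].

Definition components (G : finGroupoid) : {set {set G}} :=
  equivalence_partition (@gconnected G) [set: G].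

Definition autGroupoid (G : finGroupoid) (x : G) : finGroupoid :=
  @FinGroupoid unit (fun _ _ => gmor x x)
    (fun _ => gid x)
    (fun _ _ _ h g => gcomp h g)
    (fun _ _ g => ginv g)
    (fun _ _ _ _ h g f => gcompA h g f)
    (fun _ _ g => gcomp1m g)
    (fun _ _ g => gcompm1 g)
    (fun _ _ g => gcompVm g)
    (fun _ _ g => gcompmV g).

Section Twisted.
Variable R : realType.

(** [coc g2 g1] is theta([g2|g1]). *)
Record cocycle (G : finGroupoid) := Cocycle {
  coc : forall x0 x1 x2 : G, gmor x1 x2 -> gmor x0 x1 -> R[i];
  coc_U1 : forall (x0 x1 x2 : G) (g2 : gmor x1 x2) (g1 : gmor x0 x1),
    `|coc g2 g1| = 1;
  coc_id_l : forall (x0 x1 : G) (g : gmor x0 x1), coc (gid x1) g = 1;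
  coc_id_r : forall (x0 x1 : G) (g : gmor x0 x1), coc g (gid x0) = 1;
  coc_closed : forall (x0 x1 x2 x3 : G)
      (g3 : gmor x2 x3) (g2 : gmor x1 x2) (g1 : gmor x0 x1),
    coc g2 g1 * (coc (gcomp g3 g2) g1)^-1
      * coc g3 (gcomp g2 g1) * (coc g3 g2)^-1 = 1 }.

Definition cocycle_restr (G : finGroupoid) (theta : cocycle G) (x : G) :
    cocycle (autGroupoid x) :=
  @Cocycle (autGroupoid x)
    (fun _ _ _ g2 g1 => coc theta (g2 : gmor x x) (g1 : gmor x x))
    (fun _ _ _ g2 g1 => coc_U1 theta (g2 : gmor x x) (g1 : gmor x x))
    (fun _ _ g => coc_id_l theta (g : gmor x x))
    (fun _ _ g => coc_id_r theta (g : gmor x x))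
    (fun _ _ _ _ g3 g2 g1 =>
       coc_closed theta (g3 : gmor x x) (g2 : gmor x x) (g1 : gmor x x)).

Record twrep (G : finGroupoid) (theta : cocycle G) := TwRep {
  rep_obj :> G -> vectType R[i];
  rep_mor : forall x y : G, gmor x y -> 'Hom(rep_obj x, rep_obj y);
  rep_id : forall x : G, rep_mor (gid x) = \1%VF;
  rep_comp : forall (x0 x1 x2 : G) (g2 : gmor x1 x2) (g1 : gmor x0 x1),
    (rep_mor g2 \o rep_mor g1)%VF = coc theta g2 g1 *: rep_mor (gcomp g2 g1) }.

Record twmor (G : finGroupoid) (theta : cocycle G) (F F' : twrep theta) :=
  TwMor {
    twmor_hom :> forall x : G, 'Hom(F x, F' x);
    twmor_nat : forall (x y : G) (g : gmor x y),
      (twmor_hom y \o rep_mor F g)%VF = (rep_mor F' g \o twmor_hom x)%VF }.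

(** Kernels and cokernels of twisted representations are computed objectwise,
    hence so is the exactness of 0 -> F' -> F -> F'' -> 0. *)
Definition short_exact (G : finGroupoid) (theta : cocycle G)
    (F' F F'' : twrep theta) (i : twmor F' F) (p : twmor F F'') : Prop :=
  forall x : G,
    [/\ lker (i x) = 0%VS, limg (i x) = lker (p x) & limg (p x) = fullv].

Definition exact_relation (G : finGroupoid) (theta : cocycle G)
    (u v : zexpr (twrep theta)) : Prop :=
  exists (F' F F'' : twrep theta) (i : twmor F' F) (p : twmor F F''),
    [/\ short_exact i p, u = ZGen F & v = ZAdd (ZGen F') (ZGen F'')].

(** The abelian group with a generator [F] for each twisted representation F
    and a relation [F] = [F'] + [F''] for each short exact sequence
    0 -> F' -> F -> F'' -> 0.  Taking F' = 0 shows that [F] depends only on the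
    isomorphism class of F. *)
Definition Rep (G : finGroupoid) (theta : cocycle G) : abGroupType :=
  presented (@exact_relation G theta).

End Twisted.

(* Main.v *)
(** Restriction to the chosen objects is inverted by extension.  Choose
    [s_y : x -> y] for every [y] in the component of [x].  A representation [V]
    of [Aut x] extends by [V] on the component of [x] and by [0] elsewhere, where
    [g : y -> z] acts by [theta(g|s_y) theta(s_z|h)^-1 V(h)] with
    [h = s_z^-1 g s_y]: this is the only choice for which [s_y] and [s_z] act
    as if they were identities.  A representation [F] is filtered by its
    truncations to unions of components, with graded pieces isomorphic to the
    extensions of its restrictions through the maps [F(s_y)]. *)
From HB Require Import structures.
Require Import Defs.
From mathcomp Require Import all_boot all_order all_algebra.
From mathcomp Require Import boolp reals complex ring.

Set Implicit Arguments.
Unset Strict Implicit.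
Unset Printing Implicit Defensive.

Import GRing.Theory Num.Theory.

Local Open Scope ring_scope.

(** * Abelian groups as commutative monoid laws, and additive maps *)

HB.instance Definition _ (A : abGroupType) := Monoid.isComLaw.Build A abg_zero
  (@abg_add A) (@abg_addA A) (@abg_addC A) (@abg_add0 A).

Definition abg_additive (A B : abGroupType) (f : A -> B) :=
  {morph f : x y / abg_add x y}.

Section AbGroupCancel.
Variable A : abGroupType.

Lemma abg_addI : right_injective (@abg_add A).
Proof.
move=> x y z /(congr1 (abg_add (abg_opp x))).
by rewrite !abg_addA abg_addN !abg_add0.
Qed.

Lemma abg_addr0 (x : A) : abg_add x abg_zero = x.
Proof. by rewrite abg_addC abg_add0. Qed.

Lemma abg_addIl (x y : A) : abg_add y x = x -> y = abg_zero.
Proof. by move=> E; apply: (@abg_addI x); rewrite abg_addC E abg_addr0. Qed.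

End AbGroupCancel.

Section AbGroupMorphism.
Variables A B C : abGroupType.

Lemma abg_additive0 (f : A -> B) : abg_additive f -> f abg_zero = abg_zero.
Proof. by move=> fD; apply: (@abg_addIl _ (f abg_zero)); rewrite -fD abg_add0. Qed.

Lemma abg_additiveN (f : A -> B) : abg_additive f -> {morph f : x / abg_opp x}.
Proof.
move=> fD x; apply: (@abg_addI _ (f x)).
by rewrite -fD ![abg_add _ (abg_opp _)]abg_addC !abg_addN abg_additive0.
Qed.

Lemma abg_additive_comp (g : B -> C) (f : A -> B) :
  abg_additive g -> abg_additive f -> abg_additive (g \o f).
Proof. by move=> gD fD x y /=; rewrite fD gD. Qed.

Lemma abg_additive_id : abg_additive (@id A).
Proof. by []. Qed.

Lemma abg_additive_sum (f : A -> B) (I : Type) (s : seq I) (F : I -> A) :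
  abg_additive f ->
  f (\big[@abg_add A/abg_zero]_(i <- s) F i)
    = \big[@abg_add B/abg_zero]_(i <- s) f (F i).
Proof. by move=> fD; apply: big_morph => //; apply: abg_additive0. Qed.

End AbGroupMorphism.

(** * The universal property of a presented abelian group *)

Section PresentedTheory.
Variables (T : Type) (rel : zexpr T -> zexpr T -> Prop).
Variable A : abGroupType.

Definition presented_gen (t : T) : presented rel := presented_pi rel (ZGen t).

(** Every element is the class of an expression in the generators, so induction on that expression
    suffices. The cancellation identities below are thereby checked on classes of representations
    only. *)
Lemma presented_hom_eq (f g : presented rel -> A) :
  abg_additive f -> abg_additive g ->
  (forall t, f (presented_gen t) = g (presented_gen t)) -> f =1 g.
Proof.
move=> fD gD fg x; rewrite -(presented_reprK x).
elim: (presented_repr x) => [t||u IH|u IHu v IHv].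
- exact: fg.
- by rewrite -[presented_pi _ _]/(@abg_zero (presented rel)) !abg_additive0.
- rewrite -presented_piN -[presented_opp _]/(@abg_opp (presented rel) _).
  by rewrite !abg_additiveN // IH.
- rewrite -presented_piD -[presented_add _ _]/(@abg_add (presented rel) _ _).
  by rewrite fD gD IHu IHv.
Qed.

Variable phi : T -> A.

Fixpoint zeval (u : zexpr T) : A :=
  match u with
  | ZGen t => phi t
  | ZZero => abg_zero
  | ZOpp u => abg_opp (zeval u)
  | ZAdd u v => abg_add (zeval u) (zeval v)
  end.

Hypothesis phi_rel : forall u v, rel u v -> zeval u = zeval v.

Lemma zeval_zeqv u v : zeqv rel u v -> zeval u = zeval v.
Proof.
elim=> {u v} //=.
- by move=> u v w _ -> _ ->.
- by move=> u u' _ ->.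
- by move=> u u' v v' _ -> _ ->.
- by move=> u v w; apply: abg_addA.
- by move=> u v; apply: abg_addC.
- by move=> u; apply: abg_add0.
- by move=> u; apply: abg_addN.
Qed.

(** The homomorphism induced by [phi], computed on a chosen representative; by [zeval_zeqv] the
    choice is immaterial. *)
Definition presented_lift (x : presented rel) : A := zeval (presented_repr x).

Lemma presented_lift_gen t : presented_lift (presented_gen t) = phi t.
Proof. exact: (zeval_zeqv (presented_piK rel (ZGen t))). Qed.

Lemma presented_lift_additive : abg_additive presented_lift.
Proof. by move=> x y; apply: (zeval_zeqv (presented_piK _ _)). Qed.

End PresentedTheory.

(** * Spaces and linear maps switched to zero by a boolean *)

Section Gate.
Variable F : fieldType.
Implicit Types U V W : vectType F.

Definition gate (b : bool) V : vectType F := if b then V else 'rV[F]_0.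

Definition gate_map (b c : bool) V W (f : 'Hom(V, W)) : 'Hom(gate b V, gate c W) :=
  match b, c return 'Hom(gate b V, gate c W) with
  | true, true => f
  | _, _ => 0
  end.

Lemma rV0_full : fullv = 0%VS :> {vspace 'rV[F]_0}.
Proof. by apply/vspaceP => v; rewrite memvf memv0 thinmx0 eqxx. Qed.

Lemma gate_map_id b V : gate_map b b (\1%VF : 'End(V)) = \1%VF.
Proof. by case: b => //; apply/lfunP => v; apply/rowP; case. Qed.

(** A closed middle gate kills the composite, so the middle gate must be open whenever both outer
    ones are. *)
Lemma gate_map_comp b c d U V W (g : 'Hom(V, W)) (f : 'Hom(U, V)) :
  (b && d ==> c) ->
  (gate_map c d g \o gate_map b c f)%VF = gate_map b d (g \o f)%VF.
Proof.
by case: b c d => [] [] [] // H; rewrite ?comp_lfun0l ?comp_lfun0r //; have := H isT.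
Qed.

Lemma gate_map_eq b c V W (f g : 'Hom(V, W)) :
  (b && c -> f = g) -> gate_map b c f = gate_map b c g.
Proof. by case: b c => [] [] // ->. Qed.

Lemma gate_map_scale b c V W a (f : 'Hom(V, W)) :
  gate_map b c (a *: f) = a *: gate_map b c f.
Proof. by case: b c => [] [] //=; rewrite scaler0. Qed.

(** Bijectivity in the form in which [short_exact] speaks of kernels and images. *)
Definition lfun_iso V W (f : 'Hom(V, W)) := lker f = 0%VS /\ limg f = fullv.

Lemma lker0_full V W : lker (0 : 'Hom(V, W)) = fullv.
Proof. by apply/vspaceP => v; rewrite memv_ker lfunE memvf /= eqxx. Qed.

Lemma lfun_iso_id V : lfun_iso (\1%VF : 'End(V)).
Proof.
split; last exact: lim1g.
by apply/vspaceP => v; rewrite memv_ker id_lfunE memv0.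
Qed.

Lemma gate_map_iso (b c : bool) V W (f : 'Hom(V, W)) :
  b = c -> (b -> lfun_iso f) -> lfun_iso (gate_map b c f).
Proof.
move=> <-; case: b => [/(_ isT)//|_] /=.
by rewrite /lfun_iso lker0_full lim0g !rV0_full.
Qed.

End Gate.

(** * Classes of twisted representations and of their truncations *)

Section Classes.
Variables (R : realType) (G : finGroupoid) (theta : cocycle R G).
Implicit Types F : twrep theta.

Definition rep_class F : Rep theta := presented_gen (@exact_relation R G theta) F.

Lemma rep_class_exact F' F F'' (i : twmor F' F) (p : twmor F F'') :
  short_exact i p -> rep_class F = abg_add (rep_class F') (rep_class F'').
Proof.
move=> ip; rewrite /abg_add /= presented_piD; apply/presented_piP/zeqv_rel.
by exists F', F, F'', i, p.
Qed.

Lemma zero_twmor_nat F F' x y (g : gmor x y) :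
  ((0 : 'Hom(F y, F' y)) \o rep_mor F g = rep_mor F' g \o 0)%VF.
Proof. by rewrite comp_lfun0l comp_lfun0r. Qed.

Definition zero_twmor F F' : twmor F F' := TwMor (@zero_twmor_nat F F').

Definition null_rep F := forall x, fullv = 0%VS :> {vspace F x}.

(** With zero maps, 0 -> F -> F -> F -> 0 is exact when F vanishes, which gives [F] = [F] + [F]. *)
Lemma rep_class_null F : null_rep F -> rep_class F = abg_zero.
Proof.
move=> F0; apply: (@abg_addIl _ (rep_class F)); apply/esym.
apply: (@rep_class_exact _ _ _ (zero_twmor F F) (zero_twmor F F)) => x.
by rewrite /= lker0_full lim0g F0.
Qed.

Section Truncation.
Variables (P : pred G) (Pmor : forall x y, gmor x y -> P x = P y).

Lemma trunc_id F x : gate_map (P x) (P x) (rep_mor F (gid x)) = \1%VF.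
Proof. by rewrite rep_id gate_map_id. Qed.

Lemma trunc_comp F (x0 x1 x2 : G) (g2 : gmor x1 x2) (g1 : gmor x0 x1) :
  (gate_map (P x1) (P x2) (rep_mor F g2)
     \o gate_map (P x0) (P x1) (rep_mor F g1))%VF
    = coc theta g2 g1 *: gate_map (P x0) (P x2) (rep_mor F (gcomp g2 g1)).
Proof.
rewrite gate_map_comp ?rep_comp ?gate_map_scale // (Pmor g1).
by apply/implyP => /andP[].
Qed.

(** By [Pmor], [P] is a union of components; this is the restriction of [F] to it, extended by
    zero. *)
Definition trunc F : twrep theta := TwRep (trunc_id F) (@trunc_comp F).

End Truncation.

(** An isomorphism gives an exact sequence 0 -> Z -> F -> F' -> 0 with Z zero. The truncation of [F]
    to the empty union serves as Z. *)
Lemma rep_class_iso F F' (T : twmor F F') :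
  (forall x, lfun_iso (T x)) -> rep_class F = rep_class F'.
Proof.
move=> isoT.
have pred0mor (x y : G) : gmor x y -> pred0 x = pred0 y by [].
pose Z := trunc pred0mor F.
have Z0 : null_rep Z by move=> x; apply: rV0_full.
rewrite (@rep_class_exact Z _ _ (zero_twmor Z F) T).
  by rewrite (@rep_class_null Z Z0) abg_add0.
by move=> x; case: (isoT x) => kT iT; rewrite /= kT iT lker0_full lim0g rV0_full.
Qed.

Lemma trunc_twmor_nat (P Q : pred G) (Pmor : forall x y, gmor x y -> P x = P y)
    (Qmor : forall x y, gmor x y -> Q x = Q y) F x y (g : gmor x y) :
  (gate_map (P y) (Q y) \1 \o rep_mor (trunc Pmor F) g
    = rep_mor (trunc Qmor F) g \o gate_map (P x) (Q x) \1)%VF.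
Proof.
rewrite /= !gate_map_comp ?comp_lfun1l ?comp_lfun1r //; apply/implyP => /andP[].
  by rewrite (Qmor _ _ g).
by rewrite (Pmor _ _ g).
Qed.

(** The identity where both [P] and [Q] hold and zero elsewhere; this covers inclusions and
    projections alike. *)
Definition trunc_twmor P Q Pmor Qmor F : twmor (trunc Pmor F) (trunc Qmor F) :=
  @TwMor R G theta (trunc Pmor F) (trunc Qmor F)
    (fun x => gate_map (P x) (Q x) \1) (@trunc_twmor_nat P Q Pmor Qmor F).

(** The inclusion of the truncation to [Q] and the projection onto the one to [S] form a short exact
    sequence: at each object one of the two maps is the identity and the other is zero, or all
    spaces vanish. *)
Lemma rep_class_trunc_split (P Q S : pred G)
    (Pmor : forall x y, gmor x y -> P x = P y)
    (Qmor : forall x y, gmor x y -> Q x = Q y)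
    (Smor : forall x y, gmor x y -> S x = S y) F :
    (forall x, P x = Q x || S x) -> (forall x, ~~ (Q x && S x)) ->
  rep_class (trunc Pmor F)
    = abg_add (rep_class (trunc Qmor F)) (rep_class (trunc Smor F)).
Proof.
move=> PQS QS0.
apply: (rep_class_exact (i := trunc_twmor Qmor Pmor F)
                        (p := trunc_twmor Pmor Smor F)) => x.
have [k1 i1] := lfun_iso_id (F x).
rewrite /= (PQS x); case: (Q x) (S x) (QS0 x) => [] [] //= _;
  by rewrite ?k1 ?i1 ?lker0_full ?lim0g ?rV0_full.
Qed.

Lemma rep_class_trunc_all (P : pred G)
    (Pmor : forall x y, gmor x y -> P x = P y) F :
  (forall x, P x) -> rep_class (trunc Pmor F) = rep_class F.
Proof.
move=> allP; apply/esym.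
(* The truncation of [F] to [predT] has the same spaces and maps as [F] by computation, so
   naturality between truncations applies to [F] itself. *)
have predTmor (x y : G) : gmor x y -> predT x = predT y by [].
have nat := trunc_twmor_nat predTmor Pmor F.
apply: (rep_class_iso (T := @TwMor R G theta F (trunc Pmor F)
  (fun x => gate_map (predT x) (P x) \1) nat)) => x.
apply: (@gate_map_iso _ true (P x) (F x) (F x) \1%VF) => [|_].
  by rewrite allP.
exact: lfun_iso_id.
Qed.

(** Induction along the filtration by the unions of the [P i]: each new index splits off one
    summand, disjoint from the rest since it does not recur in [s]. *)
Lemma rep_class_trunc_sum (I : eqType) (P : I -> pred G)
    (Pmor : forall i x y, gmor x y -> P i x = P i y)
    (Pdisj : forall i j x, P i x -> P j x -> i = j) F (s : seq I)
    (smor : forall x y, gmor x y -> has (P^~ x) s = has (P^~ y) s) :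
  uniq s ->
  rep_class (trunc smor F)
    = \big[@abg_add (Rep theta)/abg_zero]_(i <- s) rep_class (trunc (Pmor i) F).
Proof.
elim: s smor => [|i s IHs] smor /= => [_|/andP[iNs us]].
  by rewrite big_nil rep_class_null // => x; apply: rV0_full.
have smor' x y : gmor x y -> has (P^~ x) s = has (P^~ y) s.
  by move=> g; apply: eq_has => j; apply: Pmor g.
rewrite big_cons -(IHs smor') //; apply: rep_class_trunc_split => // x.
apply/negP => /andP[Pix /hasP[j js Pjx]].
by case/negP: iNs; rewrite (Pdisj _ _ _ Pix Pjx).
Qed.

Lemma coc_neq0 (x0 x1 x2 : G) (g2 : gmor x1 x2) (g1 : gmor x0 x1) :
  coc theta g2 g1 != 0.
Proof. by rewrite -normr_eq0 coc_U1 oner_eq0. Qed.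

Lemma coc_mul (x0 x1 x2 x3 : G)
    (g3 : gmor x2 x3) (g2 : gmor x1 x2) (g1 : gmor x0 x1) :
  coc theta g2 g1 * coc theta g3 (gcomp g2 g1)
    = coc theta g3 g2 * coc theta (gcomp g3 g2) g1.
Proof.
have := coc_closed theta g3 g2 g1.
move=> /(congr1 ( *%R^~ (coc theta g3 g2 * coc theta (gcomp g3 g2) g1))).
rewrite mul1r => <-.
by rewrite mulrA mulfVK ?coc_neq0 // mulrAC mulfVK ?coc_neq0.
Qed.

(** Both composites of F(g) and F(g^-1) are nonzero multiples of the identity; one gives
    injectivity, the other surjectivity. *)
Lemma rep_mor_iso F x y (g : gmor x y) : lfun_iso (rep_mor F g).
Proof.
split; apply/vspaceP => v; rewrite ?memvf ?memv_ker ?memv0.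
  apply/idP/idP => [/eqP gv0|/eqP->]; last by rewrite linear0.
  have /lfunP/(_ v) := rep_comp F (ginv g) g.
  rewrite comp_lfunE gv0 linear0 gcompVm rep_id !lfunE /= lfunE /=.
  by move/esym/eqP; rewrite scaler_eq0 (negPf (coc_neq0 _ _)).
have /lfunP/(_ v) := rep_comp F g (ginv g).
rewrite comp_lfunE gcompmV rep_id !lfunE /= lfunE /= => E.
rewrite -[v](scalerK (coc_neq0 g (ginv g))) -E -linearZ.
exact: memv_img (memvf _).
Qed.

End Classes.

(** * Connected components and their chosen representatives *)

Section Connected.
Variable G : finGroupoid.

Lemma gconnected_mor (x y z : G) :
  gmor y z -> gconnected x y = gconnected x z.
Proof.
move=> g; apply/idP/idP => /card_gt0P[s _]; apply/card_gt0P.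
  by exists (gcomp g s).
by exists (gcomp (ginv g) s).
Qed.

Lemma gconnected_refl (x : G) : gconnected x x.
Proof. by apply/card_gt0P; exists (gid x). Qed.

Lemma gconnected_equiv : equivalence_rel (@gconnected G).
Proof.
move=> x y z; split; first exact: gconnected_refl.
move=> /card_gt0P[g _]; apply/idP/idP => /card_gt0P[s _]; apply/card_gt0P.
  by exists (gcomp s (ginv g)).
by exists (gcomp s g).
Qed.

Lemma gcompKV (x y z : G) (g : gmor y z) (f : gmor x z) :
  gcomp g (gcomp (ginv g) f) = f.
Proof. by rewrite gcompA gcompmV gcomp1m. Qed.

Variables (X : {set G}) (hX : is_transversal X (components G) [set: G]).

Let in_component (x y : G) : (y \in pblock (components G) x) = gconnected x y.
Proof.
by apply: pblock_equivalence_partition; rewrite ?in_setT // => u v w _ _ _;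
  apply: gconnected_equiv.
Qed.

Lemma transversal_connected_ex (y : G) : exists2 x, x \in X & gconnected x y.
Proof.
have [/and3P[/eqP covP _ _] _ _] := and3P hX.
have yP : pblock (components G) y \in components G.
  by rewrite pblock_mem // covP in_setT.
exists (transversal_repr y X (pblock (components G) y)).
  exact: (repr_mem_transversal hX).
(* Membership in the block of [y] yields a morphism out of [y]; its inverse has the required
   direction. *)
have := repr_mem_pblock hX y yP; rewrite in_component => /card_gt0P[g _].
by apply/card_gt0P; exists (ginv g).
Qed.

Lemma transversal_connected_inj (x x' y : G) :
  x \in X -> x' \in X -> gconnected x y -> gconnected x' y -> x = x'.
Proof.
move=> xX x'X xy /card_gt0P[g _].
have [/and3P[_ tiP _] _ _] := and3P hX.
apply: (pblock_inj hX xX x'X); apply/esym/same_pblock => //.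
by rewrite in_component (gconnected_mor x g).
Qed.

End Connected.

(** * Restriction to one automorphism group *)

Section Restriction.
Variables (R : realType) (G : finGroupoid) (theta : cocycle R G) (x : G).

Definition restr (F : twrep theta) : twrep (cocycle_restr theta x) :=
  @TwRep R (autGroupoid x) (cocycle_restr theta x) (fun=> F x)
    (fun _ _ (g : gmor x x) => rep_mor F g) (fun=> rep_id F x)
    (fun _ _ _ g2 g1 => rep_comp F (g2 : gmor x x) (g1 : gmor x x)).

Definition restr_twmor (F F' : twrep theta) (T : twmor F F') :
    twmor (restr F) (restr F') :=
  @TwMor R (autGroupoid x) (cocycle_restr theta x) (restr F) (restr F')
    (fun=> T x) (fun _ _ (g : gmor x x) => twmor_nat T g).

Definition class_restr : Rep theta -> Rep (cocycle_restr theta x) :=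
  presented_lift (fun F => rep_class (restr F)).

Lemma restr_rel u v : exact_relation u v ->
  zeval (fun F => rep_class (restr F)) u = zeval (fun F => rep_class (restr F)) v.
Proof.
move=> [F' [F [F'' [i [p [ip -> ->]]]]]] /=.
by apply: (rep_class_exact (i := restr_twmor i) (p := restr_twmor p)) => a;
  apply: (ip x).
Qed.

Lemma class_restr_additive : abg_additive class_restr.
Proof. exact: presented_lift_additive restr_rel. Qed.

Lemma class_restr_gen F : class_restr (rep_class F) = rep_class (restr F).
Proof. exact: presented_lift_gen restr_rel F. Qed.

End Restriction.

(** * Extension from one automorphism group, and its composites with restriction *)

Section Extension.
Variables (R : realType) (G : finGroupoid) (theta : cocycle R G) (x : G).
Implicit Types V : twrep (cocycle_restr theta x).

(** The choice of [s_y], with [None] off the component of [x]. The morphism chosen at [x] itself may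
    differ from the identity. *)
Definition section_mor (y : G) : option (gmor x y) := [pick s : gmor x y].

Lemma section_morP y : gconnected x y -> exists s, section_mor y = Some s.
Proof.
move=> /card_gt0P[s _]; rewrite /section_mor.
by case: pickP => [t _|/(_ s)//]; exists t.
Qed.

(** Views the action of [V] as indexed by morphisms of [G], so that composites are taken in [G]. *)
Definition aut_mor V (h : gmor x x) : 'End(V tt) :=
  @rep_mor R (autGroupoid x) _ V tt tt h.

Lemma aut_mor_comp V (h k : gmor x x) :
  (aut_mor V h \o aut_mor V k)%VF = coc theta h k *: aut_mor V (gcomp h k).
Proof. exact: (@rep_comp R (autGroupoid x) _ V tt tt tt h k). Qed.

Lemma aut_mor_id V : aut_mor V (gid x) = \1%VF.
Proof. exact: (@rep_id R (autGroupoid x) _ V tt). Qed.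

Definition loop y z (s : gmor x y) (t : gmor x z) (g : gmor y z) : gmor x x :=
  gcomp (ginv t) (gcomp g s).

(** In any representation F, with h the loop, t h = g s gives F(g) F(s) = theta(g|s) theta(t|h)^-1
    F(t) F(h); this is the scalar that occurs. *)
Definition ext_coef y z (s : gmor x y) (t : gmor x z) (g : gmor y z) : R[i] :=
  coc theta g s / coc theta t (loop s t g).

Definition ext_map V y z (g : gmor y z) : 'End(V tt) :=
  match section_mor y, section_mor z with
  | Some s, Some t => ext_coef s t g *: aut_mor V (loop s t g)
  | _, _ => 0
  end.

Lemma loop_comp y0 y1 y2 (s0 : gmor x y0) (s1 : gmor x y1) (s2 : gmor x y2)
    (g2 : gmor y1 y2) (g1 : gmor y0 y1) :
  gcomp (loop s1 s2 g2) (loop s0 s1 g1) = loop s0 s2 (gcomp g2 g1).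
Proof. by rewrite /loop -!gcompA gcompKV. Qed.

Lemma loopE y z (s : gmor x y) (t : gmor x z) (g : gmor y z) :
  gcomp t (loop s t g) = gcomp g s.
Proof. exact: gcompKV. Qed.

(** The scalar part of the twisted composition law. It combines the cocycle identities for the
    triples (g2, g1, s0), (g2, s1, h1) and (s2, h2, h1), linked by g1 s0 = s1 h1 and g2 s1 = s2
    h2. *)
Lemma ext_coef_comp y0 y1 y2 (s0 : gmor x y0) (s1 : gmor x y1) (s2 : gmor x y2)
    (g2 : gmor y1 y2) (g1 : gmor y0 y1) :
  ext_coef s1 s2 g2 * ext_coef s0 s1 g1
      * coc theta (loop s1 s2 g2) (loop s0 s1 g1)
    = coc theta g2 g1 * ext_coef s0 s2 (gcomp g2 g1).
Proof.
rewrite /ext_coef -(loop_comp s0 s1 s2).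
set h2 := loop s1 s2 g2; set h1 := loop s0 s1 g1.
have E1 := coc_mul theta g2 g1 s0.
have E2 := coc_mul theta g2 s1 h1.
have E3 := coc_mul theta s2 h2 h1.
rewrite -(loopE s0 s1 g1) -/h1 in E1.
rewrite -(loopE s1 s2 g2) -/h2 in E2.
rewrite [RHS]mulrA -E1.
(* The second and third identities are solved for one value each; what remains is an identity of
   fractions with nonzero denominators. *)
have -> : coc theta g2 (gcomp s1 h1)
    = coc theta g2 s1 * coc theta (gcomp s2 h2) h1 / coc theta s1 h1.
  by rewrite -E2 mulrC mulKf ?coc_neq0.
have -> : coc theta h2 h1 = coc theta s2 h2 * coc theta (gcomp s2 h2) h1
    / coc theta s2 (gcomp h2 h1).
  by rewrite -E3 mulfK ?coc_neq0.
by field; rewrite !coc_neq0.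
Qed.

Lemma ext_id V y :
  gate_map (gconnected x y) (gconnected x y) (ext_map V (gid y)) = \1%VF.
Proof.
rewrite -gate_map_id; apply: gate_map_eq => /andP[/section_morP[s E] _].
rewrite /ext_map E /ext_coef /loop gcomp1m gcompVm coc_id_l coc_id_r divr1.
by rewrite scale1r aut_mor_id.
Qed.

Lemma ext_comp V y0 y1 y2 (g2 : gmor y1 y2) (g1 : gmor y0 y1) :
  (gate_map (gconnected x y1) (gconnected x y2) (ext_map V g2)
     \o gate_map (gconnected x y0) (gconnected x y1) (ext_map V g1))%VF
  = coc theta g2 g1 *:
    gate_map (gconnected x y0) (gconnected x y2) (ext_map V (gcomp g2 g1)).
Proof.
rewrite gate_map_comp; last first.
  by apply/implyP => /andP[]; rewrite (gconnected_mor x g1).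
rewrite -gate_map_scale; apply: gate_map_eq => /andP[c0 /section_morP[s2 E2]].
have [s0 E0] := section_morP c0.
have [s1 E1] : exists s1, section_mor y1 = Some s1.
  by apply: section_morP; rewrite -(gconnected_mor x g1).
rewrite /ext_map E0 E1 E2 -comp_lfunZl -comp_lfunZr !scalerA aut_mor_comp scalerA.
by rewrite ext_coef_comp loop_comp.
Qed.

Definition ext V : twrep theta :=
  @TwRep R G theta (fun y => gate (gconnected x y) (V tt))
    (fun y z g => gate_map (gconnected x y) (gconnected x z) (ext_map V g))
    (ext_id V) (@ext_comp V).

Lemma ext_twmor_nat V W (T : twmor V W) y z (g : gmor y z) :
  (gate_map (gconnected x z) (gconnected x z) (T tt) \o rep_mor (ext V) g
   = rep_mor (ext W) g \o gate_map (gconnected x y) (gconnected x y) (T tt))%VF.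
Proof.
rewrite /= !gate_map_comp; do ?by apply/implyP => /andP[].
apply: gate_map_eq => _; rewrite /ext_map.
case: (section_mor y) => [s|]; case: (section_mor z) => [t|];
  rewrite ?comp_lfun0l ?comp_lfun0r // -comp_lfunZr -comp_lfunZl.
by congr (_ *: _); apply: (@twmor_nat R (autGroupoid x) _ V W T tt tt).
Qed.

Definition ext_twmor V W (T : twmor V W) : twmor (ext V) (ext W) :=
  @TwMor R G theta (ext V) (ext W)
    (fun y => gate_map (gconnected x y) (gconnected x y) (T tt)) (ext_twmor_nat T).

Definition class_ext : Rep (cocycle_restr theta x) -> Rep theta :=
  presented_lift (fun V => rep_class (ext V)).

(** An extended sequence is the original one at objects in the component of [x] and consists of zero
    spaces elsewhere, so it stays exact. *)
Lemma ext_rel u v : exact_relation u v ->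
  zeval (fun V => rep_class (ext V)) u = zeval (fun V => rep_class (ext V)) v.
Proof.
move=> [F' [F [F'' [i [p [ip -> ->]]]]]] /=.
apply: (rep_class_exact (i := ext_twmor i) (p := ext_twmor p)) => y /=.
case: (gconnected x y) => /=; first exact: (ip tt).
by rewrite lker0_full lim0g rV0_full.
Qed.

Lemma class_ext_additive : abg_additive class_ext.
Proof. exact: presented_lift_additive ext_rel. Qed.

Lemma class_ext_gen V : class_ext (rep_class V) = rep_class (ext V).
Proof. exact: presented_lift_gen ext_rel V. Qed.

(** Since [s_x] may be nontrivial, the extension acts at [x] by a conjugate of [V]; the isomorphism
    back to [V] is V(s_x). *)
Lemma restr_ext V : rep_class (restr x (ext V)) = rep_class V.
Proof.
have [s Es] := section_morP (gconnected_refl x).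
have autE (h : gmor x x) : (aut_mor V s \o ext_map V h)%VF
    = (aut_mor V h \o aut_mor V s)%VF.
  rewrite /ext_map Es -comp_lfunZr !aut_mor_comp loopE scalerA.
  by rewrite /ext_coef mulfVK ?coc_neq0.
(* The gate at [x] is open only by a proof, so it remains in the source type; the target gate is
   literally [true]. *)
pose T (b : unit) : 'Hom(gate (gconnected x x) (V tt), V b) :=
  gate_map (gconnected x x) true (@rep_mor R (autGroupoid x) _ V tt b s).
have nat (a b : unit) (h : gmor x x) :
  (T b \o @rep_mor R (autGroupoid x) _ (restr x (ext V)) a b h
   = @rep_mor R (autGroupoid x) _ V a b h \o T a)%VF.
  by rewrite /T; case: a b => -[]; rewrite /= gconnected_refl; apply: autE.
apply: (rep_class_iso (T := @TwMor R (autGroupoid x) _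
  (restr x (ext V)) V T nat)) => b.
apply: (@gate_map_iso _ _ true (V tt) (V b) _ (gconnected_refl x)) => _.
exact: rep_mor_iso.
Qed.

Lemma restr_ext_null V y : ~~ gconnected x y ->
  rep_class (restr y (ext V)) = abg_zero.
Proof.
move=> /negPf xy; apply: rep_class_null => -[]; rewrite /= xy.
exact: rV0_full.
Qed.

Lemma ext_restr F :
  rep_class (ext (restr x F)) = rep_class (trunc (@gconnected_mor G x) F).
Proof.
pose T y : 'Hom(F x, F y) := if section_mor y is Some s then rep_mor F s else 0.
have nat y z (g : gmor y z) :
  (gate_map (gconnected x z) (gconnected x z) (T z) \o rep_mor (ext (restr x F)) g
   = rep_mor (trunc (@gconnected_mor G x) F) g
       \o gate_map (gconnected x y) (gconnected x y) (T y))%VF.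
  rewrite /= !gate_map_comp; do ?by apply/implyP => /andP[].
  apply: gate_map_eq => /andP[/section_morP[s Es] /section_morP[t Et]].
  rewrite /T /ext_map Es Et -comp_lfunZr.
  (* Both F(g) F(s) and F(t) F(h) are multiples of F(t h), and [ext_coef] is the ratio of their
     scalars. *)
  rewrite [RHS]rep_comp -(loopE s t g).
  rewrite [(_ \o _)%VF](rep_comp F t (loop s t g)) scalerA.
  by rewrite /ext_coef mulfVK ?coc_neq0.
apply: (rep_class_iso (T := @TwMor R G theta (ext (restr x F)) (trunc _ F)
  (fun y => gate_map (gconnected x y) (gconnected x y) (T y)) nat)) => y.
apply: (@gate_map_iso _ _ _ (F x) (F y) (T y)) => // /section_morP[s Es].
rewrite /T Es; exact: (rep_mor_iso F s).
Qed.

Lemma class_extK : cancel class_ext (class_restr x).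
Proof.
apply: presented_hom_eq => [||V].
- exact: (abg_additive_comp (@class_restr_additive _ _ _ _) class_ext_additive).
- exact: abg_additive_id.
- by rewrite /= class_ext_gen class_restr_gen restr_ext.
Qed.

Lemma class_ext_null y w :
  ~~ gconnected x y -> class_restr y (class_ext w) = abg_zero.
Proof.
move=> xy; move: w; apply: (@presented_hom_eq _ _ _ (class_restr y \o class_ext)
                                             (fun=> abg_zero)) => [||V].
- exact: (abg_additive_comp (@class_restr_additive _ _ _ _) class_ext_additive).
- by move=> u v; rewrite abg_add0.
- by rewrite /= class_ext_gen class_restr_gen restr_ext_null.
Qed.

End Extension.

(** * Assembling the isomorphism from all chosen objects *)

Theorem theorem15 (R : realType) (G : finGroupoid) (theta : cocycle R G)
    (X : {set G}) (hX : is_transversal X (components G) [set: G]) :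
  abg_isomorphic (Rep theta)
    (dsum (fun x : {x : G | x \in X} => Rep (cocycle_restr theta (val x)))).
Proof.
pose I := {x : G | x \in X}.
pose f (v : Rep theta) : dsum (fun x : I => Rep (cocycle_restr theta (val x))) :=
  fun x => class_restr (val x) v.
(* The inverse adds up the extensions of all coordinates. *)
pose g (w : dsum (fun x : I => Rep (cocycle_restr theta (val x)))) :=
  \big[@abg_add (Rep theta)/abg_zero]_(x : I) class_ext (w x).
exists f; split.
  move=> u v; apply: functional_extensionality_dep => x.
  exact: class_restr_additive.
exists g.
- apply: presented_hom_eq => [||F].
  + move=> u v; rewrite /g /f -big_split; apply: eq_bigr => x _.
    by rewrite class_restr_additive class_ext_additive.
  + exact: abg_additive_id.
  pose P (i : I) : pred G := gconnected (val i).
  pose Pmor (i : I) x y : gmor x y -> P i x = P i y :=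
    @gconnected_mor G (val i) x y.
  have Pdisj (i j : I) x : P i x -> P j x -> i = j.
    by move=> ix jx; apply/val_inj/(transversal_connected_inj hX _ _ ix jx);
      apply: valP.
  have smor x y : gmor x y ->
      has (P^~ x) (index_enum I) = has (P^~ y) (index_enum I).
    by move=> h; apply: eq_has => i; apply: Pmor h.
  (* The sum of the extended restrictions is the class of [F] truncated to the union of all chosen
     components, which is all of [G]. *)
  transitivity (rep_class (trunc smor F)).
    rewrite (rep_class_trunc_sum Pmor Pdisj) ?index_enum_uniq //.
    apply: eq_bigr => i _.
    rewrite /f class_restr_gen class_ext_gen; exact: ext_restr.
  apply: rep_class_trunc_all => y.
  have [x xX xy] := transversal_connected_ex hX y.
  by apply/hasP; exists (exist _ x xX); rewrite ?mem_index_enum.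
- move=> w; apply: functional_extensionality_dep => y; rewrite /f /g.
  rewrite abg_additive_sum; last exact: class_restr_additive.
  (* At coordinate [y] only the extension from [y] survives: the others vanish there, as distinct
     chosen objects are not connected. *)
  rewrite (bigD1 y) //= big1 => [|x xNy]; first by rewrite abg_addr0 class_extK.
  apply: class_ext_null; apply: contraNN xNy => xy.
  by apply/eqP/val_inj/(transversal_connected_inj hX _ _ xy (gconnected_refl _));
    apply: valP.
Qed.
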